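(* For every integer $k\ge 0$, $|\mathcal{U}_{2k+1}(231,1432)|=|\mathcal{S}_k|$, where $\mathcal{S}_k$ is the set of Schröder paths of semilength $k$ having no horizontal step on the horizontal axis (i.e. $|\mathcal{S}_k|$ is the $k$-th little Schröder number).
   Context: West's stack-sorting map $s$ is defined recursively on finite sequences of distinct positive integers: $s$ sends the empty sequence to itself, and if $\pi$ is a nonempty such sequence with largest entry $n$, writing $\pi=LnR$ one sets $s(\pi)=s(L)s(R)n$. A permutation $\pi\in S_n$ (one-line notation) is uniquely sorted if exactly one permutation $\sigma\in S_n$ satisfies $s(\sigma)=\pi$. Let $\mathcal{U}_n$ be the set of uniquely sorted permutations in $S_n$. A permutation $\pi$ contains a pattern $\tau\in S_m$ if some subsequence of $\pi$ of length $m$ has its entries in the same relative order as $\tau$; otherwise $\pi$ avoids $\tau$. $\mathcal{U}_{n}(\tau^{(1)},\dots,\tau^{(\ell)})$ denotes the set of permutations in $\mathcal{U}_n$ avoiding all of $\tau^{(1)},\dots,\tau^{(\ell)}$. A Schröder path of semilength $k$ is a lattice path from $(0,0)$ to $(2k,0)$ using up steps $(1,1)$, down steps $(1,-1)$ and horizontal steps $(2,0)$, never going below the horizontal axis; a horizontal step lies on the horizontal axis if it goes from $(a,0)$ to $(a+2,0)$. *)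

(* Defs.v *)
From HB Require Import structures.
From mathcomp Require Import all_boot all_order all_fingroup all_algebra.

Set Implicit Arguments.
Unset Strict Implicit.
Unset Printing Implicit Defensive.

Import Order.TTheory GRing.Theory Num.Theory.

Local Open Scope nat_scope.

(* The recursive calls are on strictly shorter words, so [size w] is enough
   fuel; [stack_sortE] below is the usual recursion s(LnR) = s(L)s(R)n. *)
Definition maxword (w : seq nat) : nat := foldr maxn 0 w.

Fixpoint stack_sort_rec (fuel : nat) (w : seq nat) : seq nat :=
  if fuel is f.+1 then
    if w is [::] then [::] else
    let n := maxword w in
    let i := index n w in
    stack_sort_rec f (take i w) ++ stack_sort_rec f (drop i.+1 w) ++ [:: n]
  else [::].

Definition stack_sort (w : seq nat) : seq nat := stack_sort_rec (size w) w.

Lemma stack_sort_nil : stack_sort [::] = [::].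
Proof. by []. Qed.

Lemma maxword_mem (x : nat) (w : seq nat) : maxword (x :: w) \in x :: w.
Proof.
elim: w x => [|y w IHw] x; first by rewrite /maxword /= maxn0 mem_head.
rewrite [maxword _]/= -/(maxword w) -[maxn y _]/(maxword (y :: w)).
by rewrite inE /maxn; case: ifP; rewrite ?eqxx // IHw orbT.
Qed.

Lemma stack_sort_rec_fuel (f g : nat) (w : seq nat) :
  size w <= f -> size w <= g -> stack_sort_rec f w = stack_sort_rec g w.
Proof.
elim: f g w => [|f IHf] [|g] [|x w] // lewf lewg.
have := maxword_mem x w; rewrite -index_mem /stack_sort_rec -/stack_sort_rec.
move: (x :: w) lewf lewg => {x}w lewf lewg; set i := index _ _ => ltiw.
have st : size (take i w) < size w by rewrite size_take ltiw.
have sd : size (drop i.+1 w) < size w.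
  by rewrite size_drop ltn_subrL (leq_ltn_trans _ ltiw).
congr (_ ++ (_ ++ _)); apply: IHf.
- by rewrite -ltnS (leq_trans st).
- by rewrite -ltnS (leq_trans st).
- by rewrite -ltnS (leq_trans sd).
- by rewrite -ltnS (leq_trans sd).
Qed.

Lemma stack_sortE (L R : seq nat) (n : nat) :
    {in L, forall x, x < n} -> {in R, forall x, x < n} ->
  stack_sort (L ++ n :: R) = stack_sort L ++ stack_sort R ++ [:: n].
Proof.
move=> ltL ltR; rewrite /stack_sort.
have nL : n \notin L by apply/negP => /ltL; rewrite ltnn.
have maxE : maxword (L ++ n :: R) = n.
  have maxR : maxword R <= n.
    rewrite /maxword; elim: R {L ltL nL} ltR => //= x R IHR ltR.
    rewrite geq_max ltnW ?ltR ?mem_head ?IHR // => y yR.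
    by rewrite ltR // inE yR orbT.
  elim: L ltL {nL} => [|x L IHL] ltL; first exact/maxn_idPl.
  rewrite /= -/(maxword _) IHL; first by apply/maxn_idPr/ltnW/ltL/mem_head.
  by move=> y yL; rewrite ltL // inE yL orbT.
have indE : index n (L ++ n :: R) = size L.
  by rewrite index_cat (negPf nL) /= eqxx addn0.
have -> : size (L ++ n :: R) = (size L + size R).+1.
  by rewrite size_cat /= addnS.
case defw: (L ++ n :: R) => [|x w]; first by case: (L) defw.
rewrite /stack_sort_rec -/stack_sort_rec -{x w}defw maxE indE.
rewrite take_size_cat // -[L ++ _ :: R]cat_rcons drop_size_cat ?size_rcons //.
rewrite (@stack_sort_rec_fuel _ (size L) L) ?leq_addr //.
by rewrite (@stack_sort_rec_fuel _ (size R) R) ?leq_addl.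
Qed.

(* One-line notation, with the entries of 'I_n shifted to {1, ..., n}. *)
Definition one_line (n : nat) (p : 'S_n) : seq nat :=
  [seq (p i : nat).+1 | i <- enum 'I_n].

Definition uniquely_sorted (n : nat) : {set 'S_n} :=
  [set p : 'S_n |
    #|[set q : 'S_n | stack_sort (one_line q) == one_line p]| == 1].

Definition same_relative_order (u v : seq nat) : bool :=
  (size u == size v) &&
  [forall i : 'I_(size u), forall j : 'I_(size u),
     (nth 0 u i < nth 0 u j) == (nth 0 v i < nth 0 v j)].

(* The subsequences of [w] are the words [mask m w] for bit vectors [m]. *)
Definition contains (w tau : seq nat) : bool :=
  [exists m : (size w).-tuple bool, same_relative_order (mask m w) tau].

Definition uniquely_sorted_avoiding (n : nat) (taus : seq (seq nat)) :
    {set 'S_n} :=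
  [set p in uniquely_sorted n |
    all (fun tau => ~~ contains (one_line p) tau) taus].

Inductive step : Type := Up | Down | Horiz.

Definition step_code (s : step) : option bool :=
  match s with Up => Some true | Down => Some false | Horiz => None end.
Definition step_decode (c : option bool) : step :=
  match c with Some true => Up | Some false => Down | None => Horiz end.
Lemma step_codeK : cancel step_code step_decode.
Proof. by case. Qed.
HB.instance Definition _ := Finite.copy step (can_type step_codeK).

Definition step_vector (s : step) : int * int :=
  match s with
  | Up => (1, 1)%R
  | Down => (1, -1)%R
  | Horiz => (2, 0)%R
  end.

(* The lattice point reached from the origin after the first [i] steps. *)
Definition point (p : seq step) (i : nat) : int * int :=
  (\sum_(s <- take i p) step_vector s)%R.

Definition is_schroder_path (k : nat) (p : seq step) : bool :=
  (point p (size p) == ((2 * k)%:Z, 0)%R) &&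
  [forall i : 'I_(size p).+1, (0 <= (point p i).2)%R].

Definition horiz_on_axis (p : seq step) : bool :=
  [exists i : 'I_(size p),
    (nth Up p i == Horiz) && ((point p i).2 == 0%R)].

Lemma is_schroder_path_size (k : nat) (p : seq step) :
  is_schroder_path k p -> size p <= 2 * k.
Proof.
case/andP=> /eqP + _; rewrite /point take_size => /(congr1 fst) /=.
rewrite -lez_nat => <-.
elim: p => [|s p IHp]; first by rewrite big_nil.
rewrite big_cons /= -addn1 PoszD addrC lerD //.
by case: s.
Qed.

(* Every step advances the abscissa by at least 1, so bounding the number of
   steps by 2k loses no path: see [is_schroder_path_size]. *)
Definition little_schroder_paths (k : nat) : {set {bseq (2 * k) of step}} :=
  [set p : {bseq (2 * k) of step} |
    is_schroder_path k p && ~~ horiz_on_axis p].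

(* Main.v *)
(* A stack-sorted word of length n has at most (n - 1) / 2 descents, and it has
   exactly one preimage if and only if this bound is attained ([tight]).
   Let w avoid 231 and 1432, with letters 1, ..., n, and suppose that w becomes
   stack-sorted and tight once t increasing new maxima are appended.  Write
   w = a m b with m the maximum.  By 231, all letters of a are below those of b;
   by 1432, b is increasing as soon as a is nonempty, and tightness then leaves
   b at most one letter.  So w is the word 1, or arises from a shorter word of
   the same kind by prepending m (t increases by 1), by appending m (t decreases
   by 1), or by appending m, m - 1 (t is unchanged, and is positive).  These are
   the steps of a Schroder path at height t whose horizontal steps stay off the
   axis, and the uniquely sorted words are those with t = 0. *)
Require Import Defs.
From mathcomp Require Import all_boot all_order all_fingroup all_algebra.
From mathcomp Require Import zify.

Set Implicit Arguments.
Unset Strict Implicit.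
Unset Printing Implicit Defensive.

Local Open Scope nat_scope.

(** Levi's lemma. It compares the cut given by the stack-sorting recursion with a cut at a
    prescribed letter; the second case is strict, so equal cuts fall in the first. *)
Lemma eq_cat_cases (T : eqType) (a b c d : seq T) :
  a ++ b = c ++ d ->
  (exists e, c = a ++ e /\ b = e ++ d) \/
  (exists x e, a = c ++ x :: e /\ d = x :: e ++ b).
Proof.
elim: a c => [|x a IHa] [|y c] /=.
- by move=> ->; left; exists [::].
- by move=> ->; left; exists (y :: c).
- by move=> <-; right; exists x, a.
case=> <- /IHa[[e [-> ->]]|[z [e [-> ->]]]]; first by left; exists e.
by right; exists z, e.
Qed.

Lemma mem_head_gt0 (w : seq nat) : 0 < size w -> head 0 w \in w.
Proof. by case: w => // x w _; apply: mem_head. Qed.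

Lemma mem_last_gt0 (w : seq nat) : 0 < size w -> last 0 w \in w.
Proof. by case/lastP: w => // w x _; rewrite last_rcons mem_rcons mem_head. Qed.

(** * Descents and stack-sorted words *)

Fixpoint descents (w : seq nat) : nat :=
  if w is x :: s then (if s is y :: _ then y < x else false) + descents s
  else 0.

Lemma descents_cat (a b : seq nat) (x y : nat) :
  descents (rcons a x ++ y :: b)
  = descents (rcons a x) + descents (y :: b) + (y < x).
Proof.
elim: a => [|z a IHa]; first by rewrite /= addn0 add0n addnC.
rewrite rcons_cons cat_cons.
case: a IHa => [|t a] IHa /=; first by rewrite /=; lia.
by move: IHa; rewrite !rcons_cons !cat_cons /= => ->; lia.
Qed.

Lemma descents_cat_gt0 (a b : seq nat) : 0 < size a -> 0 < size b ->
  descents (a ++ b) = descents a + descents b + (head 0 b < last 0 a).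
Proof.
case/lastP: a => [|a x] //; case: b => [|y b] // _ _.
by rewrite descents_cat last_rcons.
Qed.

Lemma descents_cat_le (a b : seq nat) :
  descents (a ++ b) <= descents a + descents b + 1.
Proof.
case: a => [|x a]; first by rewrite /=; lia.
case: b => [|y b]; first by rewrite cats0; lia.
by rewrite descents_cat_gt0 //; case: (_ < _); lia.
Qed.

Lemma descents_cat_increasing (w ms : seq nat) :
  sorted ltn ms -> {in w & ms, forall x y, x < y} ->
  descents (w ++ ms) = descents w.
Proof.
move=> srtms ltwms.
have dms : descents ms = 0.
  elim: ms srtms {ltwms} => //= x [|y s] IHs //= /andP[ltxy pth].
  by rewrite ltnNge (ltnW ltxy) /= add0n; apply: IHs.
case: ms srtms ltwms dms => [|y ms] _ ltw dms; first by rewrite cats0.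
case/lastP: w ltw => [|w x] ltw //.
by rewrite descents_cat dms ltnNge ltnW ?addn0 // ltw ?mem_head // mem_rcons mem_head.
Qed.

Lemma descents_increasing (ms : seq nat) : sorted ltn ms -> descents ms = 0.
Proof. by move=> h; rewrite -[ms]cat0s descents_cat_increasing. Qed.

(** Equality in [stack_sorted_descents]. It forces odd length, so the empty word is not tight. *)
Definition tight (w : seq nat) : bool := size w == (descents w).*2.+1.

(* The image of the stack-sorting map: [a ++ b ++ [:: n]] is the image of
   [L ++ n :: R] when [a] and [b] are the images of [L] and [R]. *)
Inductive stack_sorted : seq nat -> Prop :=
| StackSortedNil : stack_sorted [::]
| StackSortedCat a b n of stack_sorted a & stack_sorted b &
    {in a ++ b, forall x, x < n} : stack_sorted (a ++ b ++ [:: n]).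

Lemma stack_sorted_inv (w : seq nat) (n : nat) : stack_sorted (rcons w n) ->
  exists a b, [/\ w = a ++ b, stack_sorted a, stack_sorted b
                & {in w, forall x, x < n}].
Proof.
move def_v: (rcons w n) => v srt; case: v / srt def_v => [|a b m sa sb ltm].
  by case: w.
rewrite catA cats1 => /rcons_inj[-> ->].
by exists a, b.
Qed.

Lemma stack_sorted_last (w : seq nat) (x : nat) : stack_sorted w -> x \in w ->
  x <= last 0 w.
Proof.
case/lastP: w => // w n /stack_sorted_inv[a [b [_ _ _ ltn]]].
by rewrite mem_rcons inE last_rcons => /orP[/eqP-> // | /ltn /ltnW].
Qed.

Lemma stack_sorted_rcons (w : seq nat) (n : nat) :
  stack_sorted w -> {in w, forall x, x < n} -> stack_sorted (rcons w n).
Proof.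
move=> sw ltn; rewrite -cats1 -[[:: n]]cat0s.
by apply: StackSortedCat => //; [left | rewrite cats0].
Qed.

Lemma stack_sorted_increasing (w : seq nat) : sorted ltn w -> stack_sorted w.
Proof.
elim/last_ind: w => [|w n IHw]; first by left.
rewrite -cats1 (sorted_pairwise ltn_trans) pairwise_cat => /and3P[ltn pw _].
rewrite cats1; apply: stack_sorted_rcons.
  by apply: IHw; rewrite (sorted_pairwise ltn_trans).
by move=> x xw; apply: (allrelP ltn) => //; rewrite mem_head.
Qed.

(** Induction on the decomposition of [b]: the word [a] is absorbed into the first nonempty factor
    of [b], which starts with the head of [b]. Since the last letter of [a] is its largest, all of
    [a] stays below the final maximum. *)
Lemma stack_sorted_cat (a b : seq nat) : stack_sorted a -> stack_sorted b ->
  last 0 a < head 0 b -> stack_sorted (a ++ b).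
Proof.
move=> sa sb; elim: sb => [|b1 b2 n s1 IH1 s2 IH2 ltn] //.
case: b1 => [|x b1] in s1 IH1 ltn *.
  case: b2 => [|y b2] in s2 IH2 ltn * => ltab.
    rewrite /= cats1; apply: stack_sorted_rcons => // x xa.
    by apply: leq_ltn_trans ltab; apply: stack_sorted_last.
  rewrite cat0s catA cats1; apply: stack_sorted_rcons; first exact: IH2.
  move=> z; rewrite mem_cat => /orP[za|]; last by apply: ltn.
  apply: leq_ltn_trans (stack_sorted_last sa za) (ltn_trans ltab _).
  by apply: ltn; rewrite mem_head.
move=> ltab; rewrite catA; apply: StackSortedCat => //; first exact: IH1.
move=> z; rewrite -catA mem_cat => /orP[za|]; last by apply: ltn.
apply: leq_ltn_trans (stack_sorted_last sa za) (ltn_trans ltab _).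
by apply: ltn; rewrite mem_head.
Qed.

(** The final maximum creates no descent and the junction of the two factors at most one; for
    nonempty factors with d1 and d2 descents, the length is at least (2 d1 + 1) + (2 d2 + 1) + 1 = 2
    (d1 + d2 + 1) + 1. *)
Lemma stack_sorted_descents (w : seq nat) :
  stack_sorted w -> 0 < size w -> (descents w).*2.+1 <= size w.
Proof.
elim=> // a b n sa IHa sb IHb ltn _.
rewrite catA descents_cat_increasing // => [|x y /ltn + /[!inE] /eqP-> //].
rewrite !size_cat /=.
case: (posnP (size a)) => [/size0nil-> | a0].
  case: (posnP (size b)) => [/size0nil-> // | /IHb]; rewrite /=; lia.
case: (posnP (size b)) => [/size0nil-> | /IHb Hb].
  by rewrite cats0 /=; move: (IHa a0); lia.
by move: (IHa a0) (descents_cat_le a b); lia.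
Qed.

(** The equality case of [stack_sorted_descents]: an empty factor, a factor that is not tight, or a
    junction without descent would make the word too long for its descents. *)
Lemma tight_split (w a b : seq nat) (n : nat) :
  w = a ++ b -> stack_sorted a -> stack_sorted b -> {in w, forall x, x < n} ->
  tight (rcons w n) -> 0 < size w ->
  [/\ [/\ 0 < size a, stack_sorted a & tight a],
    [/\ 0 < size b, stack_sorted b & tight b] & head 0 b < last 0 a].
Proof.
move=> -> sa sb ltn.
rewrite /tight -cats1 descents_cat_increasing // => [|x y /ltn + /[!inE] /eqP-> //].
rewrite !size_cat /= => /eqP tw nw.
case: (posnP (size a)) => [/size0nil a0 | a0].
  move: tw nw ltn; rewrite a0 /=; case: (posnP (size b)) => [/size0nil-> // | b0].
  by move: (stack_sorted_descents sb b0); lia.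
case: (posnP (size b)) => [/size0nil b0 | b0].
  by move: tw (stack_sorted_descents sa a0); rewrite b0 cats0 /=; lia.
move: tw (stack_sorted_descents sa a0) (stack_sorted_descents sb b0).
rewrite descents_cat_gt0 //; case: ltnP => _ tw Ha Hb; last by lia.
by split=> //; split=> //; apply/eqP; lia.
Qed.

Lemma stack_sorted_tight_inv (w : seq nat) (n : nat) :
  stack_sorted (rcons w n) -> tight (rcons w n) -> 0 < size w ->
  exists a b, [/\ w = a ++ b, [/\ 0 < size a, stack_sorted a & tight a],
    [/\ 0 < size b, stack_sorted b & tight b], head 0 b < last 0 a
    & {in w, forall x, x < n}].
Proof.
move=> /stack_sorted_inv[a [b [Ew sa sb ltn]]] tw w0.
by have [Ta Tb dab] := tight_split Ew sa sb ltn tw w0; exists a, b.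
Qed.

(** A prefix ending inside the first factor is treated by induction. A longer one consists of the
    tight first factor, the descent at the junction and a prefix of the second factor, and the
    bounds add up. *)
Lemma tight_prefix (x y : seq nat) : stack_sorted (x ++ y) -> tight (x ++ y) ->
  0 < size x -> size x <= (descents x).*2.+1.
Proof.
have [N] := ubnP (size (x ++ y)); elim: N x y => // N IHN x y.
case/lastP: y => [|y n]; first by rewrite cats0 => _ _ /eqP->.
rewrite -rcons_cat size_rcons ltnS => szN srt tgt x0.
have nw : 0 < size (x ++ y) by rewrite size_cat ltn_addr.
case: (stack_sorted_tight_inv srt tgt nw) => a [b] [def_w [a0 sa ta] [b0 sb tb] dab _].
have szab : size a + size b <= size (x ++ y) by rewrite def_w size_cat.
case: (eq_cat_cases (esym def_w)) => [[e [def_x def_b]]|[z [e [def_a def_y]]]].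
  move: x0; rewrite def_x; case: e def_x def_b => [|z e] def_x def_b _.
    by rewrite cats0; move/eqP: ta => ->.
  rewrite def_b /= in dab.
  rewrite descents_cat_gt0 //= dab size_cat.
  have := IHN (z :: e) y; rewrite -def_b => /(_ _ sb tb isT) H.
  have szb : size b < N by lia.
  by move: (H szb); move/eqP: ta => ->; rewrite /=; lia.
apply: (IHN x (z :: e)); rewrite -?def_a //; lia.
Qed.

(** If [a] were strictly shorter than [a'], then [a'] would be [a] followed by a nonempty prefix of
    [b]. By [tight_prefix] that prefix is rich in descents, and the descent at the junction gives
    [a'] one more than tightness allows. *)
Lemma stack_sorted_split_unique (a b a' b' : seq nat) :
  [/\ 0 < size a, stack_sorted a & tight a] ->
  [/\ 0 < size b, stack_sorted b & tight b] ->
  [/\ 0 < size a', stack_sorted a' & tight a'] ->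
  [/\ 0 < size b', stack_sorted b' & tight b'] ->
  head 0 b < last 0 a -> head 0 b' < last 0 a' ->
  a ++ b = a' ++ b' -> a = a' /\ b = b'.
Proof.
wlog: a b a' b' / size a <= size a'.
  move=> W; case: (leqP (size a) (size a')) => [|/ltnW] le; first exact: W.
  by move=> A B A' B' d d' /esym E; case: (W a' b' a b le).
move=> le [a0 sa ta] [b0 sb tb] [a0' sa' ta'] _ dab dab' E.
case: (eq_cat_cases E) => [[[|x e] [Ea Eb]]|[x [e [Ea _]]]].
- by rewrite Ea Eb cats0.
- move: (ta'); rewrite Ea /tight descents_cat_gt0 //.
  move: (dab); rewrite Eb size_cat => -> /eqP.
  have := @tight_prefix (x :: e) b'; rewrite -Eb => /(_ sb tb isT).
  by move/eqP: ta => ->; set u := size (_ :: _); lia.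
by move: le; rewrite Ea size_cat /=; lia.
Qed.

(** * Preimages under the stack-sorting map *)

Lemma leq_maxword (w : seq nat) (x : nat) : x \in w -> x <= maxword w.
Proof.
rewrite /maxword; elim: w => //= y w IHw; rewrite inE leq_max.
by case/predU1P=> [-> | /IHw->]; rewrite ?leqnn ?orbT.
Qed.

Lemma split_max (w : seq nat) : uniq w -> w != [::] ->
  exists a m b, [/\ w = a ++ m :: b, {in a, forall x, x < m}
    & {in b, forall x, x < m}].
Proof.
move=> Uw nw.
have [m mw lem] : exists2 m, m \in w & {in w, forall x, x <= m}.
  exists (maxword w) => [|x xw]; last exact: leq_maxword.
  by case: w nw {Uw} => // y w _; apply: maxword_mem.
case/splitPr: mw Uw lem {nw} => a b; rewrite cat_uniq /= negb_or.
case/and4P=> _ /andP[na _] nb _ lem; exists a, m, b; split=> // x xi.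
  rewrite ltn_neqAle lem ?mem_cat ?xi // andbT.
  by apply: contraNneq na => <-.
rewrite ltn_neqAle lem ?mem_cat ?inE ?xi ?orbT // andbT.
by apply: contraNneq nb => <-.
Qed.

Lemma perm_stack_sort (w : seq nat) : uniq w -> perm_eq (stack_sort w) w.
Proof.
have [N] := ubnP (size w); elim: N w => // N IHN w szw Uw.
have [-> // | nw] := eqVneq w [::].
have [a [m [b [Ew lta ltb]]]] := split_max Uw nw.
rewrite Ew stack_sortE // -[m :: b]cat1s perm_cat //; last first.
  rewrite perm_catC perm_cat //; apply: IHN; move: szw Uw; rewrite Ew.
    by rewrite size_cat /=; lia.
  by rewrite cat_uniq /= => _ /and3P[_ _ /andP[]].
apply: IHN; move: szw Uw; rewrite Ew; first by rewrite size_cat /=; lia.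
by rewrite cat_uniq => _ /andP[].
Qed.

Lemma stack_sort_sorted (w : seq nat) : uniq w -> stack_sorted (stack_sort w).
Proof.
have [N] := ubnP (size w); elim: N w => // N IHN w szw Uw.
have [-> // | nw] := eqVneq w [::]; first by left.
have [a [m [b [Ew lta ltb]]]] := split_max Uw nw.
move: Uw szw; rewrite Ew stack_sortE // cat_uniq size_cat /=.
case/and4P=> Ua _ _ Ub sz; apply: StackSortedCat; try by apply: IHN => //; lia.
move=> x; rewrite mem_cat !(perm_mem (perm_stack_sort _)) //.
by case/orP=> [/lta | /ltb].
Qed.

(** Stated for words rather than permutations, since the two sides of the maximum need not use an
    initial interval of letters. *)
Definition preimage_of (w u : seq nat) : Prop := uniq u /\ stack_sort u = w.

Lemma preimage_perm (w u : seq nat) : preimage_of w u -> perm_eq u w.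
Proof. by case=> Uu <-; rewrite perm_sym perm_stack_sort. Qed.

Lemma preimage_cat (a b u v : seq nat) (n : nat) : uniq (a ++ b) ->
  {in a ++ b, forall x, x < n} -> preimage_of a u -> preimage_of b v ->
  preimage_of (a ++ b ++ [:: n]) (u ++ n :: v).
Proof.
move=> Uab ltn pu pv; have [[Uu <-] [Uv <-]] := (pu, pv).
have ltu : {in u, forall x, x < n}.
  by move=> x xu; apply: ltn; rewrite mem_cat -(perm_mem (preimage_perm pu)) xu.
have ltv : {in v, forall x, x < n}.
  move=> x xv; apply: ltn.
  by rewrite mem_cat -(perm_mem (preimage_perm pv)) xv orbT.
split; last by rewrite stack_sortE.
rewrite -cat1s uniq_catCA cat1s cons_uniq mem_cat.
apply/andP; split; last first.
  by rewrite (perm_uniq (perm_cat (preimage_perm pu) (preimage_perm pv))).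
by apply/negP=> /orP[/ltu | /ltv]; rewrite ltnn.
Qed.

Lemma preimage_inv (w u : seq nat) (n : nat) : preimage_of (rcons w n) u ->
  exists a b u1 u2, [/\ w = a ++ b, u = u1 ++ n :: u2, preimage_of a u1,
    preimage_of b u2 & {in w, forall x, x < n}].
Proof.
move=> pu; have [Uu Eu] := pu.
have nu : u != [::] by apply/eqP=> u0; move: Eu; rewrite u0; case: (w).
have [u1 [m [u2 [Du lt1 lt2]]]] := split_max Uu nu.
move: Eu; rewrite Du stack_sortE // catA cats1 => /rcons_inj[Ew En].
move: Uu; rewrite Du cat_uniq /= => /and4P[U1 _ _ U2].
exists (stack_sort u1), (stack_sort u2), u1, u2; split=> //; first by rewrite -En.
move=> x; rewrite -Ew -En mem_cat !(perm_mem (perm_stack_sort _)) //.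
by case/orP=> [/lt1 | /lt2].
Qed.

Lemma stack_sorted_preimage (w : seq nat) : uniq w -> stack_sorted w ->
  exists u, preimage_of w u.
Proof.
move=> Uw sw; elim: sw Uw => [|a b n _ IHa _ IHb ltn] Uw; first by exists [::].
have Uab : uniq (a ++ b) by move: Uw; rewrite catA cat_uniq => /andP[].
move: (Uab); rewrite cat_uniq => /and3P[/IHa[u pu] _ /IHb[v pv]].
by exists (u ++ n :: v); apply: preimage_cat.
Qed.

(** Cut the preimage at [n]. The images [a] and [b] of the two sides inherit unique preimages, hence
    are tight by induction. If one were empty or their junction were not a descent, [a ++ b] would
    itself be stack-sorted, which [no_join] excludes. *)
Lemma preimage_unique_tight (w u : seq nat) : uniq w -> 0 < size w ->
  preimage_of w u -> (forall v, preimage_of w v -> v = u) -> tight w.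
Proof.
have [N] := ubnP (size w); elim: N w u => // N IHN.
case/lastP=> // w n u; rewrite size_rcons ltnS => szw.
rewrite rcons_uniq => /andP[nw Uw] _ pu.
have [a [b [u1 [u2 [Ew Eu p1 p2 ltn]]]]] := preimage_inv pu => uniq_u.
have Uab : uniq (a ++ b) by rewrite -Ew.
have ltab : {in a ++ b, forall x, x < n} by rewrite -Ew.
have mk v1 v2 : preimage_of a v1 -> preimage_of b v2 ->
    v1 ++ n :: v2 = u1 ++ n :: u2.
  move=> q1 q2; rewrite -Eu; apply: uniq_u; rewrite Ew -cats1 -catA.
  exact: preimage_cat.
(* A preimage [v] of [w] would yield the two preimages [n :: v] and [rcons v n]. *)
have no_join v : preimage_of w v -> w = [::].
  move=> pv; have p0 : preimage_of [::] [::] by [].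
  have := preimage_cat (a := [::]) (b := w) Uw ltn p0 pv.
  rewrite /= cats1 => /uniq_u Eu1.
  have := @preimage_cat w [::] v [::] n; rewrite cats0 /= cats1.
  move=> /(_ Uw ltn pv p0) /uniq_u; rewrite -Eu1 => Ev.
  have := perm_size (preimage_perm pv); case: v pv Ev {Eu1} => [|y v] pv Ev sz.
    by apply: size0nil.
  case: Ev => Ey _; have : y \in w by rewrite -(perm_mem (preimage_perm pv)) mem_head.
  by rewrite Ey => /ltn; rewrite ltnn.
have [w0 | w0] := posnP (size w); first by rewrite (size0nil w0).
have nw0 : w <> [::] by move=> E; rewrite E in w0.
have a0 : 0 < size a.
  by case: (a) p1 p2 Ew => // _ p2 Eb; case: nw0; apply: (no_join u2); rewrite Eb.
have b0 : 0 < size b.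
  case: (b) p2 p1 Ew => // _ p1 Ea; case: nw0.
  by apply: (no_join u1); rewrite Ea cats0.
move: (Uab); rewrite cat_uniq => /and3P[Ua _ Ub].
have szab : size a + size b = size w by rewrite Ew size_cat.
have /eqP ta : tight a.
  apply: (IHN _ u1) => // [|v pv]; first by lia.
  have /eqP := mk v u2 pv p2; rewrite eqseq_cat; last first.
    by rewrite (perm_size (preimage_perm pv)) (perm_size (preimage_perm p1)).
  by case/andP=> /eqP.
have /eqP tb : tight b.
  apply: (IHN _ u2) => // [|v pv]; first by lia.
  by have /eqP := mk u1 v p1 pv; rewrite eqseq_cat // eqxx => /eqP[].
have sa : stack_sorted a by case: p1 => U1 <-; apply: stack_sort_sorted.
have sb : stack_sorted b by case: p2 => U2 <-; apply: stack_sort_sorted.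
have dab : head 0 b < last 0 a.
  rewrite ltnNge leq_eqVlt; apply/negP=> /orP[/eqP E|lt_join].
    have xb : head 0 b \in b by apply: mem_head_gt0.
    have xa : last 0 a \in a by apply: mem_last_gt0.
    by move: Uab; rewrite cat_uniq => /and3P[_ /hasP[]]; exists (head 0 b); rewrite // -E.
  have [v pv] := stack_sorted_preimage Uab (stack_sorted_cat sa sb lt_join).
  by apply: nw0; apply: (no_join v); rewrite Ew.
rewrite /tight size_rcons -cats1 descents_cat_increasing //; last first.
  by move=> x y /ltn + /[!inE] /eqP->.
by rewrite Ew descents_cat_gt0 // dab size_cat; apply/eqP; lia.
Qed.

(** Two preimages cut at [n] yield two splittings of [w] into images; these agree by
    [stack_sorted_split_unique], and induction applies to each factor. *)
Lemma tight_preimage_unique (w u v : seq nat) : uniq w -> tight w ->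
  preimage_of w u -> preimage_of w v -> u = v.
Proof.
have [N] := ubnP (size w); elim: N w u v => // N IHN.
case/lastP=> // w n u v; rewrite size_rcons ltnS => szw.
rewrite rcons_uniq => /andP[nw Uw] tw pu pv.
have sw : stack_sorted (rcons w n).
  by case: pu => Uu <-; apply: stack_sort_sorted.
have [a [b [u1 [u2 [Ew -> pa pb ltn]]]]] := preimage_inv pu.
have [c [d [v1 [v2 [Ew' -> pc pd _]]]]] := preimage_inv pv.
have sorted_im x y : preimage_of x y -> stack_sorted x.
  by case=> Uy <-; apply: stack_sort_sorted.
have [w0 | w0] := posnP (size w).
  have nil_im y : preimage_of [::] y -> y = [::].
    by move/preimage_perm/perm_size/size0nil.
  move: Ew Ew'; rewrite (size0nil w0).
  case: a pa => // pa; case: b pb => // pb _; case: c pc => // pc.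
  case: d pd => // pd _.
  by rewrite (nil_im _ pa) (nil_im _ pb) (nil_im _ pc) (nil_im _ pd).
have [Ta Tb dab] := tight_split Ew (sorted_im _ _ pa) (sorted_im _ _ pb) ltn tw w0.
have [Tc Td dcd] := tight_split Ew' (sorted_im _ _ pc) (sorted_im _ _ pd) ltn tw w0.
have E : a ++ b = c ++ d by rewrite -Ew.
have [Eac Ebd] := stack_sorted_split_unique Ta Tb Tc Td dab dcd E.
rewrite -Eac in pc; rewrite -Ebd in pd.
move: Uw szw; rewrite Ew cat_uniq size_cat => /and3P[Ua _ Ub] sz.
case: Ta Tb => a0 _ ta [b0 _ tb].
congr (_ ++ _ :: _); first by apply: (IHN a) => //; lia.
by apply: (IHN b) => //; lia.
Qed.

(** * Inserting and removing a letter *)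

Lemma sorted_cat_ltn (a b : seq nat) :
  sorted ltn (a ++ b) = [&& sorted ltn a, sorted ltn b & allrel ltn a b].
Proof.
rewrite !(sorted_pairwise ltn_trans) pairwise_cat.
by rewrite andbC -andbA.
Qed.

Lemma sorted_cat_join (a b : seq nat) : sorted ltn (a ++ b) ->
  0 < size a -> 0 < size b -> last 0 a < head 0 b.
Proof.
rewrite sorted_cat_ltn => /and3P[_ _ ab].
case/lastP: a ab => // a x; case: b => // y b ab _ _.
by rewrite last_rcons; apply: (allrelP ab); rewrite ?mem_rcons mem_head.
Qed.

(** This is what a horizontal step needs: a descent from [m] to [x] is paid for by one more maximum
    at the end. The induction follows the factors [b] and [c] of the given word. *)
Lemma stack_sorted_insert (a ms : seq nat) (m x M : nat) :
  stack_sorted (a ++ m :: ms) -> {in a, forall y, y < m} ->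
  sorted ltn (m :: ms) -> x < m -> {in a ++ m :: ms, forall y, y < M} ->
  stack_sorted (a ++ m :: x :: ms ++ [:: M]).
Proof.
have [N] := ubnP (size a + size ms); elim: N a ms M => // N IHN a ms M.
case/lastP: ms => [|ms n] szN srt lta sm ltxm ltM.
  rewrite -[a ++ _]/(a ++ [:: m] ++ [:: x] ++ [:: M]) catA.
  apply: StackSortedCat => //; first exact: stack_sorted_increasing.
  move=> y; rewrite mem_cat mem_seq1 => /orP[/ltM // | /eqP->].
  by apply: ltn_trans ltxm (ltM _ _); rewrite mem_cat mem_head orbT.
move: srt; rewrite -rcons_cons -rcons_cat.
case/stack_sorted_inv=> b [c [/esym Ebc sb sc lt_n]].
move: szN; rewrite size_rcons => szN.
have [[e [Ea Ec]]|[z [e [Eb [= Ez Ems]]]]] := eq_cat_cases Ebc.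
  (* The cut lies before [m]: insert into the second factor, with the old maximum [n] in the role of
     [M]. *)
  rewrite Ea -catA; have -> : b ++ e ++ m :: x :: rcons ms n ++ [:: M]
      = b ++ (e ++ m :: x :: ms ++ [:: n]) ++ [:: M].
    by rewrite -cats1 -!catA /= -!catA.
  have in_a y : y \in e -> y \in a by rewrite Ea mem_cat => ->; rewrite orbT.
  have sm1 : sorted ltn (m :: ms).
    by move: sm; rewrite -cats1 -cat_cons sorted_cat_ltn => /and3P[].
  apply: StackSortedCat => //.
    apply: IHN => //; first by move: szN; rewrite Ea size_cat; lia.
    + by rewrite -Ec.
    + by move=> y /in_a /lta.
    + by move=> y yi; apply: lt_n; rewrite -Ebc Ec mem_cat yi orbT.
  move=> y yi; have [-> | ny] := eqVneq y x.
    by apply: ltn_trans ltxm (ltM _ _); rewrite mem_cat mem_head orbT.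
  apply: ltM; move: yi; rewrite Ea -cats1 !(mem_cat, inE) (negPf ny) /=.
  by case/or4P=> [-> | -> | -> | ] //; rewrite ?orbT // => /orP[] ->; rewrite ?orbT.
move: Ez Ems Eb => <- {z} Ems Eb.
(* The cut lies after [m]: insert into the first factor and close it with [M'], the letter following
   the cut. The remaining letters [c'] are increasing and form the second factor. *)
case def_c: (rcons c n) => [|M' c']; first by case: (c) def_c.
have Ecn : rcons ms n = e ++ M' :: c' by rewrite Ems -def_c -rcons_cat.
move: sm ltM; rewrite Ecn -(cat_cons m) sorted_cat_ltn => /and3P[sme sc' me] ltM.
have -> : a ++ m :: x :: (e ++ M' :: c') ++ [:: M]
    = (a ++ m :: x :: e ++ [:: M']) ++ c' ++ [:: M].
  by rewrite -!catA /= -!catA.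
have ltM' : {in m :: e, forall y, y < M'}.
  by move=> y yi; apply: (allrelP me); rewrite ?mem_head.
apply: StackSortedCat.
- apply: IHN => //; first by move: szN; rewrite Ems size_cat; lia.
    by rewrite -Eb.
  move=> y; rewrite mem_cat => /orP[/lta ltym|/ltM' //].
  by apply: ltn_trans ltym (ltM' _ _); rewrite mem_head.
- by apply: stack_sorted_increasing; apply: path_sorted sc'.
move=> y yi; have [-> | ny] := eqVneq y x.
  by apply: ltn_trans ltxm (ltM _ _); rewrite mem_cat mem_head orbT.
apply: ltM; move: yi; rewrite !(mem_cat, inE) (negPf ny) /=.
by do !case/orP; move=> ->; rewrite ?orbT.
Qed.

(** The junction of the two factors must be a descent. It cannot lie just before [m], nor inside the
    increasing word [b ++ ms]. Either it lies inside [a], and induction applies to the second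
    factor, or it comes right after [m]; the second factor is then increasing and tight, so a single
    letter. *)
Lemma stack_sorted_remove (a b ms : seq nat) (m : nat) :
  stack_sorted (a ++ m :: b ++ ms) -> tight (a ++ m :: b ++ ms) ->
  sorted ltn (b ++ ms) -> 0 < size a -> 0 < size b ->
  {in a ++ b, forall y, y < m} -> {in ms, forall y, m < y} ->
  [/\ size b = 1, 0 < size ms & stack_sorted (a ++ ms)].
Proof.
have [N] := ubnP (size a); elim: N a ms => // N IHN a ms szN.
case/lastP: ms => [|ms n].
  rewrite cats0 => srt _ _ _ b0 ltm _.
  have /(stack_sorted_last srt) : m \in a ++ m :: b by rewrite mem_cat mem_head orbT.
  rewrite last_cat /= leqNgt ltm // mem_cat.
  by case/lastP: (b) b0 => // s x _; rewrite last_rcons mem_rcons mem_head orbT.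
rewrite -rcons_cat -rcons_cons -rcons_cat => srt tw sbm a0 b0 ltm ltms.
have sbms : sorted ltn (b ++ ms).
  by move: sbm; rewrite -cats1 sorted_cat_ltn => /and3P[].
have w0 : 0 < size (a ++ m :: b ++ ms) by rewrite size_cat /= addnS.
have [c [d [/esym Ecd [c0 sc tc] [d0 sd td] dcd lt_n]]] :=
  stack_sorted_tight_inv srt tw w0.
rewrite size_rcons.
have [[e [Ea Ed]]|[z [e [Ec [= Ez Ems]]]]] := eq_cat_cases Ecd.
  case: e => [|z e] in Ea Ed *.
    move: dcd; rewrite Ed /= ltnNge ltnW ?ltm // Ea cats0.
    by rewrite mem_cat mem_last_gt0.
  have in_a y : y \in z :: e -> y \in a by rewrite Ea mem_cat => ->; rewrite orbT.
  have [|||||sb1 _ srt'] := IHN (z :: e) ms _ _ _ sbms isT b0.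
  + by move: szN; rewrite Ea size_cat; move: c0; lia.
  + by rewrite -Ed.
  + by rewrite -Ed.
  + move=> y; rewrite mem_cat => /orP[/in_a ya|yb]; apply: ltm.
      by rewrite mem_cat ya.
    by rewrite mem_cat yb orbT.
  + by move=> y yi; apply: ltms; rewrite mem_rcons inE yi orbT.
  split=> //; rewrite -cats1 Ea -catA [(z :: e) ++ _]catA.
  apply: StackSortedCat => // y yi; apply: lt_n; rewrite -Ecd Ed.
  by move: yi; rewrite !(mem_cat, inE); do !case/orP; move=> ->; rewrite ?orbT.
move: Ez Ems Ec => <- {z} Ems Ec.
case: e => [|z e] in Ems Ec *; last first.
  have /= ltj : last 0 (z :: e) < head 0 d.
    by apply: sorted_cat_join => //; rewrite -Ems.
  by move: dcd; rewrite Ec last_cat /= ltnNge ltnW.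
have sz1 : size d = 1.
  by move: td; rewrite /tight -[d]/([::] ++ d) -Ems descents_increasing // => /eqP.
have bms : size b + size ms = 1 by rewrite -size_cat Ems.
have ms0 : ms = [::] by apply: size0nil; lia.
have [c1 [c2 [Ea s1 s2 _]]] : exists c1 c2, [/\ a = c1 ++ c2, stack_sorted c1,
    stack_sorted c2 & {in a, forall x, x < m}].
  by apply: stack_sorted_inv; rewrite -cats1 -Ec.
split=> //; first by lia.
rewrite ms0 Ea -catA; apply: StackSortedCat => // y yi; apply: lt_n.
by rewrite mem_cat Ea yi.
Qed.

(** The first factor is just [m]: a longer one ends with its largest letter, which is at least [m],
    so it reaches past [b] into [ms], where no junction can be a descent. *)
Lemma stack_sorted_remove_head (b ms : seq nat) (m : nat) :
  stack_sorted (m :: b ++ ms) -> tight (m :: b ++ ms) ->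
  sorted ltn ms -> 0 < size b ->
  {in b, forall y, y < m} -> {in ms, forall y, m < y} ->
  exists ms' n, ms = rcons ms' n /\ stack_sorted (b ++ ms').
Proof.
case/lastP: ms => [|ms n].
  case/lastP: b => // b x srt _ _ _ ltm _.
  have /(stack_sorted_last srt) : m \in m :: rcons b x ++ [::] by rewrite mem_head.
  by rewrite cats0 /= last_rcons leqNgt ltm // mem_rcons mem_head.
rewrite -rcons_cat -rcons_cons => srt tw sms b0 ltm ltms.
have [c [d [Ecd [c0 sc tc] [d0 sd td] dcd lt_n]]] :=
  stack_sorted_tight_inv srt tw isT.
exists ms, n; split=> //; case: c => // z c in Ecd c0 sc tc dcd *.
case: Ecd => Em Ecd; rewrite -{z}Em in c0 sc tc dcd *.
case: c => [|z c] in Ecd c0 sc tc dcd *; first by rewrite Ecd.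
have lem : m <= last 0 (m :: z :: c) by apply: stack_sorted_last; rewrite ?mem_head.
have sms' : sorted ltn ms.
  by move: sms; rewrite -cats1 sorted_cat_ltn => /and3P[].
have [[e [Ez Ed]]|[x [e [Eb Ems]]]] := eq_cat_cases (esym Ecd).
  have : last 0 (z :: c) \in b.
    by rewrite Ez mem_cat /= mem_last.
  by move/ltm; rewrite ltnNge lem.
have /= ltj : last 0 (x :: e) < head 0 d.
  by apply: sorted_cat_join => //; rewrite cat_cons -Ems.
move: dcd => /=; move: Eb => /(congr1 (last 0)) /=; rewrite last_cat /= => ->.
by rewrite ltnNge ltnW.
Qed.

(** * Pattern avoidance *)

Definition avoids231 (w : seq nat) : Prop :=
  forall x y z, subseq [:: x; y; z] w -> z < x -> x < y -> False.

Definition avoids1432 (w : seq nat) : Prop :=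
  forall x y z t, subseq [:: x; y; z; t] w -> x < t -> t < z -> z < y -> False.

Lemma containsP (w tau : seq nat) :
  reflect (exists2 u, subseq u w & same_relative_order u tau) (contains w tau).
Proof.
apply: (iffP existsP) => [[m rel]|[u /subseqP[m szm ->] rel]].
  by exists (mask m w) => //; apply: mask_subseq.
have szm' : size m == size w by rewrite szm.
by exists (Tuple szm').
Qed.

Lemma same_relative_orderP (u v : seq nat) :
  reflect (size u = size v /\ forall i j, i < size u -> j < size u ->
             (nth 0 u i < nth 0 u j) = (nth 0 v i < nth 0 v j))
          (same_relative_order u v).
Proof.
apply: (iffP andP) => [[/eqP sz /forallP rel]|[sz rel]]; split=> //.
- move=> i j iu ju; move/forallP: (rel (Ordinal iu)) => /(_ (Ordinal ju)).
  by move/eqP.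
- exact/eqP.
by apply/forallP=> i; apply/forallP=> j; rewrite rel.
Qed.

Lemma contains231 (w : seq nat) :
  ~~ contains w [:: 2; 3; 1] <-> avoids231 w.
Proof.
split=> [/containsP nc x y z sub ltzx ltxy|av].
  apply: nc; exists [:: x; y; z] => //; apply/same_relative_orderP; split=> //.
  by case=> [|[|[|i]]] [|[|[|j]]] //= _ _; lia.
apply/containsP=> -[u sub /same_relative_orderP[]].
case: u sub => [|x [|y [|z []]]] // sub _ rel.
by apply: (av x y z sub); rewrite -?[z < x]/(nth 0 [:: x; y; z] 2 < nth 0 [:: x; y; z] 0)
  -?[x < y]/(nth 0 [:: x; y; z] 0 < nth 0 [:: x; y; z] 1) rel.
Qed.

Lemma contains1432 (w : seq nat) :
  ~~ contains w [:: 1; 4; 3; 2] <-> avoids1432 w.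
Proof.
split=> [/containsP nc x y z t sub ltxt lttz ltzy|av].
  apply: nc; exists [:: x; y; z; t] => //; apply/same_relative_orderP; split=> //.
  by case=> [|[|[|[|i]]]] [|[|[|[|j]]]] //= _ _; lia.
apply/containsP=> -[u sub /same_relative_orderP[]].
case: u sub => [|x [|y [|z [|t []]]]] // sub _ rel.
by apply: (av x y z t sub); [have := rel 0 3 | have := rel 3 2 | have := rel 2 1];
  move=> ->.
Qed.

Lemma avoids231_subseq (v w : seq nat) :
  subseq v w -> avoids231 w -> avoids231 v.
Proof.
by move=> vw av x y z sub; apply: (av x y z (subseq_trans sub vw)).
Qed.

Lemma avoids1432_subseq (v w : seq nat) :
  subseq v w -> avoids1432 w -> avoids1432 v.
Proof.
by move=> vw av x y z t sub; apply: (av x y z t (subseq_trans sub vw)).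
Qed.

Lemma subseq_rcons2 (T : eqType) (s w : seq T) (x y : T) :
  subseq (rcons s x) (rcons w y) ->
  subseq (rcons s x) w \/ x = y /\ subseq s w.
Proof.
rewrite -subseq_rev !rev_rcons /=; case: eqP => [-> | _].
  by rewrite subseq_rev; right.
by rewrite -rev_rcons subseq_rev; left.
Qed.

Lemma avoids231_cons (w : seq nat) (n : nat) : {in w, forall x, x < n} ->
  avoids231 w -> avoids231 (n :: w).
Proof.
move=> ltn av x y z /=; case: eqP => [-> | _ sub]; last exact: av sub.
move/mem_subseq=> sub _; have /ltn : y \in w by apply: sub; apply: mem_head.
by move/ltn_trans=> lt /lt; rewrite ltnn.
Qed.

Lemma avoids1432_cons (w : seq nat) (n : nat) : {in w, forall x, x < n} ->
  avoids1432 w -> avoids1432 (n :: w).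
Proof.
move=> ltn av x y z t /=; case: eqP => [-> | _ sub]; last exact: av sub.
move/mem_subseq=> sub lt1 _ _; have /ltn : t \in w.
  by apply: sub; rewrite !inE eqxx !orbT.
by move/ltn_trans=> lt; move: (lt _ lt1); rewrite ltnn.
Qed.

Lemma avoids231_rcons (w : seq nat) (n : nat) : {in w, forall x, x < n} ->
  avoids231 w -> avoids231 (rcons w n).
Proof.
move=> ltn av x y z sub; have [|[-> sub2]] := @subseq_rcons2 _ [:: x; y] w z n sub.
  exact: av.
have /ltn ltxn : x \in w by apply: (mem_subseq sub2); apply: mem_head.
by move=> /(ltn_trans ltxn); rewrite ltnn.
Qed.

Lemma avoids1432_rcons (w : seq nat) (n : nat) : {in w, forall x, x < n} ->
  avoids1432 w -> avoids1432 (rcons w n).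
Proof.
move=> ltn av x y z t sub.
have [|[-> sub2]] := @subseq_rcons2 _ [:: x; y; z] w t n sub; first exact: av.
have /ltn ltzn : z \in w by apply: (mem_subseq sub2); rewrite !inE eqxx !orbT.
by move=> _ /(ltn_trans ltzn); rewrite ltnn.
Qed.

Lemma avoids231_horiz (w : seq nat) (n : nat) : {in w, forall x, x < n} ->
  avoids231 w -> avoids231 (w ++ [:: n.+1; n]).
Proof.
move=> ltn av x y z; rewrite -[[:: n.+1; n]]/(rcons [:: n.+1] n) -rcons_cat cats1.
have lt1 : {in w, forall x, x < n.+1} by move=> a /ltn /leqW.
move=> sub; have [|[-> sub2]] := @subseq_rcons2 _ [:: x; y] _ z n sub.
  exact: avoids231_rcons.
(* If the pattern ends in the letter [n], its two other letters exceed [n], and the larger one would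
   exceed [n.+1]. *)
have ley : y <= n.+1.
  have : y \in rcons w n.+1.
    by apply: (mem_subseq sub2); rewrite !inE eqxx !orbT.
  by rewrite mem_rcons inE => /predU1P[-> // | /ltn /ltnW /leqW].
by lia.
Qed.

Lemma avoids1432_horiz (w : seq nat) (n : nat) : {in w, forall x, x < n} ->
  avoids1432 w -> avoids1432 (w ++ [:: n.+1; n]).
Proof.
move=> ltn av x y z t; rewrite -[[:: n.+1; n]]/(rcons [:: n.+1] n) -rcons_cat cats1.
have lt1 : {in w, forall x, x < n.+1} by move=> a /ltn /leqW.
move=> sub; have [|[-> sub2]] := @subseq_rcons2 _ [:: x; y; z] _ t n sub.
  exact: avoids1432_rcons.
have ley : y <= n.+1.
  have : y \in rcons w n.+1.
    by apply: (mem_subseq sub2); rewrite !inE eqxx !orbT.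
  by rewrite mem_rcons inE => /predU1P[-> // | /ltn /ltnW /leqW].
by lia.
Qed.

(** * Words of Schroder paths *)

Definition word_step (w : seq nat) (s : step) : seq nat :=
  match s with
  | Up => (size w).+1 :: w
  | Down => rcons w (size w).+1
  | Horiz => w ++ [:: (size w).+2; (size w).+1]
  end.

(** The empty path gives a one-letter word and each step adds as many letters as it advances, so the
    length is one more than the abscissa: 2k + 1 for semilength k. *)
Definition path_word (p : seq step) : seq nat := foldl word_step [:: 1] p.

Lemma path_word_rcons (p : seq step) (s : step) :
  path_word (rcons p s) = word_step (path_word p) s.
Proof. exact: foldl_rcons. Qed.

Lemma path_word_gt0 (p : seq step) : 0 < size (path_word p).
Proof.
elim/last_ind: p => // p s IHp; rewrite path_word_rcons.
by case: s => //=; rewrite ?size_rcons // size_cat addn_gt0 IHp.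
Qed.

Lemma path_word_perm (p : seq step) :
  perm_eq (path_word p) (iota 1 (size (path_word p))).
Proof.
elim/last_ind: p => // p s; rewrite path_word_rcons.
move: (path_word p) => w permw.
have iota1 n : iota 1 n.+1 = rcons (iota 1 n) n.+1.
    by rewrite -cats1 -[in LHS](addn1 n) iotaD add1n.
case: s => /=.
- by rewrite -/(iota 1 (size w).+1) iota1 perm_sym perm_rcons perm_cons perm_sym.
- by rewrite size_rcons iota1 -!cats1 perm_cat2r.
rewrite size_cat addn2 !iota1 -!cats1 -catA.
by apply: perm_cat => //; apply/permPl/(perm_catC [:: _] [:: _]).
Qed.

Lemma path_word_lt (p : seq step) :
  {in path_word p, forall x, x < (size (path_word p)).+1}.
Proof.
by move=> x; rewrite (perm_mem (path_word_perm p)) mem_iota add1n => /andP[].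
Qed.

(** The last step can be read off the word: the maximum is at the head after [Up], at the end after
    [Down], and last but one after [Horiz]. *)
Lemma path_word_inj : injective path_word.
Proof.
have head_lt p : head 0 (path_word p) < (size (path_word p)).+1.
  exact/path_word_lt/mem_head_gt0/path_word_gt0.
have last_lt p : last 0 (path_word p) < (size (path_word p)).+1.
  exact/path_word_lt/mem_last_gt0/path_word_gt0.
move=> p; elim/last_ind: p => [|p s IHp] q; case/lastP: q => [|q t] //.
- rewrite path_word_rcons => /(congr1 size); have := path_word_gt0 q.
  by case: t => /=; rewrite ?size_rcons ?size_cat /=; lia.
- rewrite path_word_rcons => /(congr1 size); have := path_word_gt0 p.
  by case: s => /=; rewrite ?size_rcons ?size_cat /=; lia.
rewrite !path_word_rcons => E.
have Es : s = t.
  move: (congr1 size E) (congr1 (head 0) E) (congr1 (last 0) E).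
  move: (path_word_gt0 p) (path_word_gt0 q).
  move: (head_lt p) (head_lt q) (last_lt p) (last_lt q).
  case: (path_word p) => // x v; case: (path_word q) => // y w.
  by case: s {E}; case: t => //=;
     rewrite ?size_rcons ?last_rcons ?size_cat ?last_cat /=; lia.
rewrite -{t}Es in E *; congr rcons; apply: IHp.
case: s E => /= [[] // | /rcons_inj[] // |] /eqP.
have [Esz | nsz] := eqVneq (size (path_word p)) (size (path_word q)).
  by rewrite eqseq_cat // => /andP[/eqP].
by move/eqP/(congr1 size); rewrite !size_cat => /eqP; rewrite eqn_add2r (negPf nsz).
Qed.

Lemma path_word_avoids (p : seq step) :
  avoids231 (path_word p) /\ avoids1432 (path_word p).
Proof.
elim/last_ind: p => [|p s [av1 av2]].
  by split=> x y z; [|move=> t] => /size_subseq.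
have lt := @path_word_lt p; rewrite path_word_rcons; case: s => /=; split.
- exact: avoids231_cons.
- exact: avoids1432_cons.
- exact: avoids231_rcons.
- exact: avoids1432_rcons.
- exact: avoids231_horiz.
- exact: avoids1432_horiz.
Qed.

(** The index is the final height. Requiring a positive height before [Down] and [Horiz] encodes
    both conditions on prefixes, which makes induction on the last step direct. *)
Inductive path_to : seq step -> nat -> Prop :=
| PathToNil : path_to [::] 0
| PathToUp p t of path_to p t : path_to (rcons p Up) t.+1
| PathToDown p t of path_to p t.+1 : path_to (rcons p Down) t
| PathToHoriz p t of path_to p t.+1 : path_to (rcons p Horiz) t.+1.

(** The height counts the maxima missing for tightness: [Up] and [Horiz] each create one descent,
    [Down] creates none. *)
Lemma path_word_descents (p : seq step) (t : nat) : path_to p t ->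
  size (path_word p) + t = (descents (path_word p)).*2.+1.
Proof.
elim=> {p t} // p t _; rewrite path_word_rcons /word_step; have lt := @path_word_lt p.
- have p0 := path_word_gt0 p; have lthd : head 0 (path_word p) < (size (path_word p)).+1.
    by apply: lt; apply: mem_head_gt0.
  by rewrite -cat1s descents_cat_gt0 // lthd size_cat /=; lia.
- rewrite size_rcons -cats1 descents_cat_increasing //; first by lia.
  by move=> x y /lt + /[!inE] /eqP->.
have := path_word_gt0 p; case/lastP: (path_word p) lt => // w x lt _ IH.
rewrite descents_cat_gt0 ?size_cat ?last_rcons //= ?leqnn; last by rewrite size_rcons.
rewrite [_ < x]ltnNge ltnW; first by rewrite addn0 /=; move: IH; lia.
by apply/leqW/lt; rewrite mem_rcons mem_head.
Qed.

Lemma path_word_sorted (p : seq step) (t : nat) (ms : seq nat) :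
  path_to p t -> size ms = t -> sorted ltn ms ->
  {in ms, forall y, size (path_word p) < y} -> stack_sorted (path_word p ++ ms).
Proof.
move=> pt; elim: pt ms => {p t} [|p t _ IH|p t _ IH|p t _ IH] ms.
- move=> /size0nil -> _ _; exact: stack_sorted_increasing.
- case/lastP: ms => // ms n; rewrite size_rcons path_word_rcons => -[szms] sms /= lt.
  rewrite -rcons_cat -cats1 -[_ :: _]cat1s -catA catA catA.
  have sms' : sorted ltn ms.
    by move: sms; rewrite -cats1 sorted_cat_ltn => /and3P[].
  have ltms : {in ms, forall y, (size (path_word p)).+1 < y}.
    by move=> y yi; apply: lt; rewrite mem_rcons inE yi orbT.
  have ltn' : (size (path_word p)).+1 < n by apply: lt; rewrite mem_rcons mem_head.
  (* The new head alone is the first factor, and the last appended letter [n] is the maximum. *)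
  rewrite -!catA [path_word p ++ _]catA; apply: StackSortedCat.
  + exact: stack_sorted_increasing.
  + by apply: IH => // y /ltms /ltnW.
  move=> y; rewrite mem_cat mem_seq1 mem_cat => /or3P[/eqP-> // | yp | yms].
    by apply: ltn_trans ltn'; apply: path_word_lt.
  move: sms; rewrite -cats1 sorted_cat_ltn => /and3P[_ _ ab].
  by apply: (allrelP ab) => //; apply: mem_head.
(* The letter added by [Down] counts as the first appended maximum of the shorter path. *)
- rewrite path_word_rcons /= => szms sms lt; rewrite cat_rcons.
  move: lt; rewrite size_rcons => lt.
  apply: IH => /=; first by rewrite szms.
    by rewrite (path_sortedE ltn_trans) sms andbT; apply/allP.
  by move=> y /[!inE] /predU1P[-> // | /lt /ltnW].
case/lastP: ms => // ms n; rewrite size_rcons path_word_rcons => -[szms] sms /= lt.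
rewrite -catA /= -cats1.
move: sms lt; rewrite -cats1 sorted_cat_ltn size_cat addn2 => /and3P[sms _ ab] lt.
have ltn' : (size (path_word p)).+2 < n by apply: lt; rewrite mem_cat mem_head orbT.
have ltp : {in path_word p, forall y, y < (size (path_word p)).+2}.
  by move=> y /path_word_lt /leqW.
have sm : sorted ltn ((size (path_word p)).+2 :: ms).
  rewrite /= (path_sortedE ltn_trans) sms andbT; apply/allP=> y yi.
  by apply: lt; rewrite mem_cat yi.
(* Of the two letters added by [Horiz], the larger counts as an appended maximum and the smaller is
   inserted after it, at the cost of [n]. *)
apply: stack_sorted_insert => //.
  apply: IH => //=; first by rewrite szms.
  move=> y /[!inE] /predU1P[-> // | yi].
  by apply: ltn_trans (lt y _); rewrite ?mem_cat ?yi // ltnS leqnSn.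
move=> y; rewrite mem_cat inE => /or3P[/ltp ylt | /eqP-> // | yms].
  exact: ltn_trans ltn'.
by apply: (allrelP ab) => //; apply: mem_head.
Qed.

(** * Lattice points and heights of paths *)

Lemma point_rcons (p : seq step) (s : step) (i : nat) :
  i <= size p -> point (rcons p s) i = point p i.
Proof. by move=> lei; rewrite /point -cats1 takel_cat. Qed.

Lemma point_last (p : seq step) (s : step) :
  point (rcons p s) (size p).+1 = (point p (size p) + step_vector s)%R.
Proof.
by rewrite /point -[X in take X (rcons _ _)](size_rcons p s) !take_size big_rcons.
Qed.

Definition nonnegative (p : seq step) : Prop :=
  forall i, i <= size p -> (0 <= (point p i).2)%R.

Definition no_axis_horiz (p : seq step) : Prop :=
  forall i, i < size p -> nth Up p i = Horiz -> (point p i).2 <> 0%R.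

Lemma nonnegativeP (p : seq step) :
  reflect (nonnegative p) [forall i : 'I_(size p).+1, (0 <= (point p i).2)%R].
Proof.
apply: (iffP forallP) => [nn i lei | nn i]; last exact: nn (leq_ord i).
by rewrite -ltnS in lei; apply: (nn (Ordinal lei)).
Qed.

Lemma no_axis_horizP (p : seq step) :
  reflect (no_axis_horiz p) (~~ horiz_on_axis p).
Proof.
apply: (iffP existsPn) => [nh i lti | nh i].
  by move: (nh (Ordinal lti)) => /= + E; rewrite E eqxx => /eqP.
by apply/andP=> -[/eqP E /eqP]; apply: nh.
Qed.

Lemma nonnegative_rcons (p : seq step) (s : step) :
  nonnegative (rcons p s) <->
  nonnegative p /\ (0 <= (point p (size p) + step_vector s).2)%R.
Proof.
rewrite -point_last; split=> [nn | [nn nns] i].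
  split=> [i lei|]; last by apply: nn; rewrite size_rcons.
  by rewrite -(point_rcons s lei); apply: nn; rewrite size_rcons leqW.
rewrite size_rcons leq_eqVlt => /predU1P[-> // | lei].
by rewrite point_rcons //; apply: nn.
Qed.

Lemma no_axis_horiz_rcons (p : seq step) (s : step) :
  no_axis_horiz (rcons p s) <->
  no_axis_horiz p /\ (s = Horiz -> (point p (size p)).2 <> 0%R).
Proof.
split=> [nh | [nh nhs] i].
  split=> [i lti E | E].
    rewrite -(point_rcons s (ltnW lti)); apply: nh; last by rewrite nth_rcons lti.
    by rewrite size_rcons leqW.
  rewrite -(point_rcons s (leqnn _)); apply: nh; first by rewrite size_rcons.
  by rewrite nth_rcons ltnn eqxx.
rewrite size_rcons ltnS leq_eqVlt => /predU1P[-> | lti].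
  by rewrite nth_rcons ltnn eqxx point_rcons.
by rewrite nth_rcons lti point_rcons 1?ltnW //; apply: nh.
Qed.

Lemma path_to_point (p : seq step) (t : nat) : path_to p t ->
  [/\ point p (size p) = ((size (path_word p)).-1%:Z, t%:Z)%R, nonnegative p
    & no_axis_horiz p].
Proof.
elim=> {p t} [|p t _ [E nn nh]|p t _ [E nn nh]|p t _ [E nn nh]].
- rewrite /point big_nil; split=> // i; rewrite leqn0 => /eqP->.
  by rewrite /point big_nil.
all: have p0 := path_word_gt0 p.
all: rewrite path_word_rcons /= ?size_rcons ?size_cat point_last E.
all: split; rewrite ?nonnegative_rcons ?no_axis_horiz_rcons ?E //.
all: by congr pair; rewrite /=; lia.
Qed.

Lemma path_to_exists (p : seq step) : nonnegative p -> no_axis_horiz p ->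
  exists t, path_to p t.
Proof.
elim/last_ind: p => [|p s IHp]; first by exists 0; constructor.
rewrite nonnegative_rcons no_axis_horiz_rcons => -[nn nns] [nh nhs].
have [t pt] := IHp nn nh; have [E _ _] := path_to_point pt.
rewrite E /= in nns nhs; case: s nns nhs => /= nns nhs.
- by exists t.+1; constructor.
- by case: t pt {E} nns {nhs} => // t pt _; exists t; constructor.
by case: t pt {E nns} nhs => [_ /(_ erefl) // | t pt _]; exists t.+1; constructor.
Qed.

Lemma schroder_path_to (k : nat) (p : seq step) :
  is_schroder_path k p && ~~ horiz_on_axis p <->
  path_to p 0 /\ size (path_word p) = 2 * k + 1.
Proof.
(* The abscissa is the predecessor of the length; positivity lets the length be recovered from
   it. *)
have p0 := path_word_gt0 p; split.
  case/andP=> /andP[/eqP Ep /nonnegativeP nn] /no_axis_horizP nh.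
  have [t pt] := path_to_exists nn nh; have [E _ _] := path_to_point pt.
  move: pt; move: Ep; rewrite E => -[szp ->] pt; split=> //; lia.
case=> pt szp; have [E nn nh] := path_to_point pt.
apply/andP; split; last exact/no_axis_horizP.
apply/andP; split; last exact/nonnegativeP.
by rewrite E szp addn1.
Qed.

(** * Avoiding words come from paths *)

Lemma perm_iota_max (a b : seq nat) (m : nat) :
  {in a, forall x, x < m} -> {in b, forall x, x < m} ->
  perm_eq (a ++ m :: b) (iota 1 (size (a ++ m :: b))) ->
  m = (size a + size b).+1 /\ perm_eq (a ++ b) (iota 1 (size (a ++ b))).
Proof.
move=> lta ltb; rewrite !size_cat /= addnS => permw.
have mN : m = (size a + size b).+1.
  apply/eqP; rewrite eqn_leq; apply/andP; split.
    have : m \in a ++ m :: b by rewrite mem_cat mem_head orbT.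
    by rewrite (perm_mem permw) mem_iota; lia.
  have : (size a + size b).+1 \in a ++ m :: b.
    by rewrite (perm_mem permw) mem_iota; lia.
  by rewrite mem_cat inE => /or3P[/lta/ltnW | /eqP-> | /ltb/ltnW].
split=> //; move: permw; rewrite -[X in iota _ X]addn1 iotaD add1n -mN.
by rewrite -cat1s perm_catCA /= cats1 perm_sym perm_rcons perm_cons perm_sym.
Qed.

Lemma subseq_pairs_sorted (w : seq nat) :
  (forall x y, subseq [:: x; y] w -> x < y) -> sorted ltn w.
Proof.
elim: w => [|x [|y w] IHw] // ltw; apply/andP; split.
  by apply: ltw; rewrite /= !eqxx sub0seq.
by apply: IHw => u v sub; apply: ltw; apply: subseq_trans sub (subseq_cons _ _).
Qed.

(** A letter of [a] above a letter of [b] would form 231 with [m] between them. Given this, a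
    decreasing pair in [b] would form 1432 with [m] and any letter of [a], here its head. *)
Lemma avoiding_split (a b : seq nat) (m : nat) :
  uniq (a ++ m :: b) -> avoids231 (a ++ m :: b) -> avoids1432 (a ++ m :: b) ->
  {in a, forall x, x < m} -> {in b, forall x, x < m} -> 0 < size a ->
  {in a & b, forall x y, x < y} /\ sorted ltn b.
Proof.
move=> Uw av1 av2 lta ltb a0.
have lt_ab : {in a & b, forall x y, x < y}.
  move=> x y xa yb; rewrite ltnNge leq_eqVlt; apply/negP=> /predU1P[Eyx | ltyx].
    move: Uw; rewrite cat_uniq => /and3P[_ /hasP[]]; exists y; rewrite ?Eyx //.
    by rewrite inE -Eyx yb orbT.
  apply: (av1 x m y) => //; last exact: lta.
  by rewrite -cat1s cat_subseq ?sub1seq //= eqxx sub1seq.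
split=> //; apply: subseq_pairs_sorted => x y sub.
have [xb yb] : x \in b /\ y \in b.
  by split; apply: (mem_subseq sub); rewrite !inE eqxx ?orbT.
rewrite ltnNge leq_eqVlt; apply/negP=> /predU1P[Eyx | ltyx].
  move: Uw; rewrite cat_uniq /= => /and4P[_ _ _ /(subseq_uniq sub)].
  by rewrite /= Eyx mem_head.
have z_a : head 0 a \in a by apply: mem_head_gt0.
apply: (av2 (head 0 a) m x y) => //; [| exact: lt_ab | exact: ltb].
by rewrite -cat1s cat_subseq ?sub1seq //= eqxx.
Qed.

(** Induction on the length of [w], removing the last step of the path to be found. The word [ms] of
    appended maxima is general because each case changes it; its size is the height. *)
Lemma path_word_surj (w ms : seq nat) :
  perm_eq w (iota 1 (size w)) -> 0 < size w -> avoids231 w -> avoids1432 w ->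
  sorted ltn ms -> {in ms, forall y, size w < y} ->
  stack_sorted (w ++ ms) -> tight (w ++ ms) ->
  exists2 p, path_to p (size ms) & path_word p = w.
Proof.
have [N] := ubnP (size w); elim: N w ms => // N IHN w ms szN permw w0.
have Uw : uniq w by rewrite (perm_uniq permw) iota_uniq.
have [||a [m [b [Ew lta ltb]]]] := @split_max w => //; first by case: (w) w0.
move: permw Uw szN; rewrite {w w0}Ew => permw Uw szN av231 av1432 sms ltms srt tw.
have [Em permab] := perm_iota_max lta ltb permw.
have szw : size (a ++ m :: b) = m by rewrite size_cat /= addnS Em.
rewrite szw in szN ltms *.
have sub_a : subseq a (a ++ m :: b) by apply: prefix_subseq.
have sub_b : subseq b (a ++ m :: b).
  by apply: subseq_trans (subseq_cons b m) (suffix_subseq _ _).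
have ltwms (s : seq nat) : subseq s (a ++ m :: b) -> {in s & ms, forall x y, x < y}.
  move=> sub x y /(mem_subseq sub) xw /ltms; apply: leq_ltn_trans.
  by move: xw; rewrite mem_cat inE => /or3P[/lta/ltnW | /eqP-> | /ltb/ltnW].
have dw : descents ((a ++ m :: b) ++ ms) = descents (a ++ m :: b).
  by apply: descents_cat_increasing => //; apply: ltwms.
move: tw; rewrite /tight dw size_cat szw => /eqP tw.
have [/size0nil a_nil | a0] := posnP (size a); have [/size0nil b_nil | b0] := posnP (size b).
(* Tightness of a one-letter word leaves no room for appended maxima. *)
- subst a b; have ms0 : size ms = 0 by move: tw; rewrite Em /=; lia.
  rewrite (size0nil ms0) /=.
  by exists [::]; [constructor | rewrite Em].
(* The maximum is at the head, so the last step is [Up]: removing it also drops the last letter of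
   [ms]. *)
- subst a; change (m = (size b).+1) in Em; change (is_true (perm_eq b (iota 1 (size b)))) in permab.
  change (m + size ms = (descents (m :: b)).*2.+1) in tw.
  have dmb : descents (m :: b) = (descents b).+1.
    rewrite -cat1s descents_cat_gt0 // ltb ?addn1 ?add0n //.
    by apply: mem_head_gt0.
  have [|ms' [n [Ems srt']]] := stack_sorted_remove_head srt _ sms b0 ltb ltms.
    by rewrite /tight (dw : descents (m :: b ++ ms) = _) -tw -cat_cons size_cat szw.
  have sms' : sorted ltn ms'.
    by move: sms; rewrite Ems -cats1 sorted_cat_ltn => /and3P[].
  have in_ms y : y \in ms' -> y \in ms by rewrite Ems mem_rcons inE orbC => ->.
  have [|||||||||p pt Ep] := IHN b ms' => //.
  + by move: szN; rewrite Em.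
  + by apply: avoids231_subseq av231; apply: subseq_cons.
  + by apply: avoids1432_subseq av1432; apply: subseq_cons.
  + by move=> y /in_ms /ltms; rewrite Em => /ltnW.
  + rewrite /tight descents_cat_increasing //; last first.
      by move=> x y xb /in_ms; apply: (ltwms b).
    by move: tw; rewrite dmb Ems size_rcons size_cat Em; lia.
  exists (rcons p Up); first by rewrite Ems size_rcons; constructor.
  by rewrite path_word_rcons Ep /= Em.
(* The maximum is at the end, so the last step is [Down]: [m] moves to the front of [ms]. *)
- subst b; rewrite cats0 in permab; rewrite addn0 in Em.
  rewrite cats1 in srt tw av231 av1432 sub_a ltwms *.
  have da : descents (rcons a m) = descents a.
    by rewrite -cats1 descents_cat_increasing // => x y /lta + /[!inE] /eqP->.
  have sm : sorted ltn (m :: ms).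
    by rewrite /= (path_sortedE ltn_trans) sms andbT; apply/allP.
  have lt_a : {in m :: ms, forall y, size a < y}.
    by move=> y; rewrite inE => /predU1P[-> | /ltms]; rewrite Em // => /ltnW.
  have [|||||||||p pt Ep] := IHN a (m :: ms) => //.
  + by move: szN; rewrite Em.
  + by apply: avoids231_subseq av231; apply: subseq_rcons.
  + by apply: avoids1432_subseq av1432; apply: subseq_rcons.
  + by rewrite -cat_rcons.
  + rewrite /tight descents_cat_increasing // => [|x y xa].
      by move: tw; rewrite da size_cat /= Em; lia.
    by rewrite inE => /predU1P[-> | yms]; [apply: lta | apply: (ltwms a)].
  exists (rcons p Down); first by constructor.
  by rewrite path_word_rcons Ep /= Em.
(* Letters on both sides: [b] turns out to be a single letter, so the last step is [Horiz], with
   [ms] nonempty and unchanged. *)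
have [lt_ab sb] := avoiding_split Uw av231 av1432 lta ltb a0.
have sbms : sorted ltn (b ++ ms).
  rewrite sorted_cat_ltn sb sms; apply/allrelP=> x y xb.
  exact: (ltwms b).
rewrite -catA in srt.
have [||sz1 ms0 srt'] := stack_sorted_remove srt _ sbms a0 b0 _ ltms.
- by rewrite /tight -(cat_cons m) catA dw size_cat szw tw.
- by move=> y; rewrite mem_cat => /orP[/lta | /ltb].
case: b sz1 {b0 sb sbms srt} => [|x []] // _ in permw Uw av231 av1432 ltb Em permab szw
  sub_a sub_b ltwms dw tw lt_ab *.
have ltax : {in a, forall y, y < x} by move=> y ya; apply: lt_ab; rewrite ?mem_head.
have lt_nil : {in [::], forall y, y < x} by [].
have [Ex] := perm_iota_max ltax lt_nil permab.
rewrite cats0 addn0 in Ex * => perma.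
have dmx : descents (a ++ [:: m; x]) = (descents a).+1.
  rewrite descents_cat_gt0 //= ltb ?mem_head // [m < _]ltnNge ltnW; first by lia.
  by apply: lta; apply: mem_last_gt0.
have [|||||||||p pt Ep] := IHN a ms => //.
- by move: szN; rewrite Em /=; lia.
- exact: avoids231_subseq av231.
- exact: avoids1432_subseq av1432.
- by move=> y /ltms; rewrite Em /=; lia.
- rewrite /tight descents_cat_increasing // => [|y z ya]; last exact: (ltwms a).
  by move: tw; rewrite dmx size_cat Em /=; lia.
exists (rcons p Horiz).
  by case: (ms) ms0 pt => // y s _; constructor.
by rewrite path_word_rcons Ep /= Em Ex /= addn1.
Qed.

(** * Permutations *)

Lemma one_line_perm (n : nat) (p : 'S_n) : perm_eq (one_line p) (iota 1 n).
Proof.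
have -> : one_line p = map succn (map val (map p (enum 'I_n))).
  by rewrite -2!map_comp.
have -> : iota 1 n = map succn (map val (enum 'I_n)).
  by rewrite val_enum_ord -(iotaDl 1 0).
apply/perm_map/perm_map/uniq_perm => [||i].
- by rewrite map_inj_uniq ?enum_uniq //; apply: perm_inj.
- exact: enum_uniq.
by rewrite mem_enum; apply/mapP; exists ((p^-1)%g i); rewrite ?mem_enum ?permKV.
Qed.

Lemma size_one_line (n : nat) (p : 'S_n) : size (one_line p) = n.
Proof. by rewrite size_map size_enum_ord. Qed.

Lemma one_line_uniq (n : nat) (p : 'S_n) : uniq (one_line p).
Proof. by rewrite (perm_uniq (one_line_perm p)) iota_uniq. Qed.

Lemma one_line_inj (n : nat) : injective (@one_line n).
Proof.
move=> p q /eq_in_map E; apply/permP=> i; apply: val_inj.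
by have /succn_inj := E i (mem_enum _ _).
Qed.

Lemma one_line_surj (n : nat) (w : seq nat) : perm_eq w (iota 1 n) ->
  exists p : 'S_n, one_line p = w.
Proof.
move=> permw; have szw : size w = n by rewrite (perm_size permw) size_iota.
have Uw : uniq w by rewrite (perm_uniq permw) iota_uniq.
have nth_in (i : 'I_n) : nth 0 w i \in iota 1 n.
  by rewrite -(perm_mem permw) mem_nth // szw.
(* The predecessor undoes the shift in [one_line]; it loses nothing because the letters of [w] are
   positive. *)
have f_lt (i : 'I_n) : (nth 0 w i).-1 < n.
  by move: (nth_in i); rewrite mem_iota; lia.
have f_inj : injective (fun i => Ordinal (f_lt i)).
  move=> i j [E]; have Enth : nth 0 w i = nth 0 w j.
    by move: (nth_in i) (nth_in j) E; rewrite !mem_iota; lia.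
  by apply/val_inj/eqP; rewrite -(nth_uniq 0 _ _ Uw) ?szw ?ltn_ord // Enth.
exists (perm f_inj); apply: (@eq_from_nth _ 0); first by rewrite size_one_line.
rewrite size_one_line => i lti; rewrite (nth_map (Ordinal lti)) ?size_enum_ord //.
rewrite permE /= nth_enum_ord //.
by move: (nth_in (Ordinal lti)); rewrite mem_iota /=; lia.
Qed.

(** Stack-sorting permutes letters, so word preimages of [one_line p] are themselves one-line words.
    For [n = 0] the empty permutation is uniquely sorted but not tight. *)
Lemma mem_uniquely_sorted (n : nat) (p : 'S_n) : 0 < n ->
  p \in uniquely_sorted n <->
  stack_sorted (one_line p) /\ tight (one_line p).
Proof.
move=> n0; have Up := one_line_uniq p; rewrite inE.
have preimageP q : preimage_of (one_line p) (one_line q)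
    <-> q \in [set q : 'S_n | stack_sort (one_line q) == one_line p].
  rewrite inE; split=> [[_ ->] // | /eqP E].
  by split; rewrite ?one_line_uniq.
have preimage_ex v : preimage_of (one_line p) v -> exists q : 'S_n, one_line q = v.
  by move/preimage_perm/perm_trans=> pv; apply/one_line_surj/pv/one_line_perm.
split=> [/cards1P[q Eq] | [srt tp]].
  have pq : preimage_of (one_line p) (one_line q).
    by apply/preimageP; rewrite Eq set11.
  split; first by case: (pq) => Uq <-; apply: stack_sort_sorted.
  apply: (preimage_unique_tight Up _ pq); first by rewrite size_one_line.
  move=> v pv; have [r Er] := preimage_ex v pv.
  move: pv; rewrite -Er => /preimageP; rewrite Eq inE => /eqP-> //.
have [u pu] := stack_sorted_preimage Up srt.
have [q Eq] := preimage_ex u pu; rewrite -Eq in pu.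
apply/cards1P; exists q; apply/setP=> r; rewrite [RHS]inE.
apply/idP/eqP => [/preimageP pr | ->]; last exact/preimageP.
by apply: one_line_inj; apply: tight_preimage_unique pr pu.
Qed.

Lemma mem_uniquely_sorted_avoiding (n : nat) (p : 'S_n) : 0 < n ->
  p \in uniquely_sorted_avoiding n [:: [:: 2; 3; 1]; [:: 1; 4; 3; 2]] <->
  exists2 s, path_to s 0 & path_word s = one_line p.
Proof.
move=> n0; rewrite inE /= andbT; split.
  case/andP=> /(mem_uniquely_sorted p n0)[srt tp] /andP[/contains231 a1 /contains1432 a2].
  apply: (@path_word_surj _ [::]); rewrite ?cats0 ?size_one_line //.
  exact: one_line_perm.
case=> s ps Es; have [a1 a2] := path_word_avoids s.
have srt : stack_sorted (path_word s ++ [::]) by apply: path_word_sorted ps _ _ _.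
have tw : tight (path_word s).
  by rewrite /tight -(path_word_descents ps) addn0.
rewrite cats0 in srt; rewrite -Es.
apply/andP; split; first by apply/(mem_uniquely_sorted p n0); rewrite -Es.
by apply/andP; split; [apply/contains231 | apply/contains1432].
Qed.

Theorem theorem6p1 (k : nat) :
  #|uniquely_sorted_avoiding (2 * k + 1) [:: [:: 2; 3; 1]; [:: 1; 4; 3; 2]]|
  = #|little_schroder_paths k|.
Proof.
(* Both sets inject into words, by [one_line] and by [path_word]; it suffices that the two images
   coincide. *)
rewrite !cardE -(size_map (@one_line _)) -[RHS](size_map (path_word \o val)).
apply/perm_size/uniq_perm => [||w].
- by rewrite map_inj_uniq ?enum_uniq //; apply: one_line_inj.
- rewrite map_inj_uniq ?enum_uniq //.
  exact: inj_comp path_word_inj val_inj.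
have n0 : 0 < 2 * k + 1 by rewrite addn1.
apply/mapP/mapP=> -[p]; rewrite mem_enum.
  case/(mem_uniquely_sorted_avoiding p n0) => s ps Es ->.
  have /schroder_path_to sk : path_to s 0 /\ size (path_word s) = 2 * k + 1.
    by rewrite Es size_one_line.
  (* The bound on the number of steps turns [s] into an element of the finite type of bounded
     sequences. *)
  have szs : size s <= 2 * k by case/andP: sk => /is_schroder_path_size.
  by exists (Bseq szs) => //; rewrite mem_enum inE.
rewrite inE => /schroder_path_to[ps szs] /= ->.
have := path_word_perm (val p); rewrite szs => /one_line_surj[q Eq].
exists q => //; rewrite mem_enum; apply/(mem_uniquely_sorted_avoiding q n0).
by exists (val p).
Qed.
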